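(* Let $G=(V,E)$ and $G'=(V',E')$ be directed acyclic graphs, let $\chi=(\mathfrak m,\mathfrak M)$ be a monitor placement for $G$, and let $f:V\to V'$ be a bijective, distance-increasing embedding $G\hookrightarrow_f G'$; equip $G'$ with the monitor placement $\chi^f=(f(\mathfrak m),f(\mathfrak M))$. Then $\mu(G\mid\chi)\ge\mu(G'\mid\chi^f)$.
   Context: For a DAG $G$, $u\preceq_G v$ means $v$ is reachable from $u$ by a directed path (including $u=v$). An embedding is an injective map $f$ with $u\preceq_G v$ iff $f(u)\preceq_{G'} f(v)$. $d_G(x,y)$ is the length of a shortest directed path from $x$ to $y$ ($\infty$ if none); $f$ is distance-increasing if $d_G(x,y)\le d_{G'}(f(x),f(y))$ for all $x,y$. A monitor placement specifies input nodes $\mathfrak m$ and output nodes $\mathfrak M$; the measurement paths are the directed paths from a node of $\mathfrak m$ to a node of $\mathfrak M$ (under $\mathrm{CSP}$: simple paths with distinct endpoints; under $\mathrm{CAP}^-$: all such directed walks except single-node paths on a node of $\mathfrak m\cap\mathfrak M$). $\mathbb P(v)$ is the set of measurement paths through $v$, $\mathbb P(U)=\bigcup_{u\in U}\mathbb P(u)$; the node set is $k$-identifiable if for all $U\ne W$ with $|U|,|W|\le k$, $\mathbb P(U)\neq\mathbb P(W)$; $\mu$ is the largest such $k\ge0$. *)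

(* Defs.v *)
From mathcomp Require Import all_boot all_order all_algebra.
From mathcomp Require Import boolp classical_sets constructive_ereal.

Set Implicit Arguments.
Unset Strict Implicit.
Unset Printing Implicit Defensive.

Local Open Scope nat_scope.

(* A directed graph on a finite node set V is given by its edge relation.     *)
(* In [acyclic], [cycle e c] with c = [:: x] is a self-loop at x.             *)
Definition acyclic (V : finType) (e : rel V) : Prop :=
  forall c : seq V, c <> [::] -> ~~ cycle e c.

(* [connect e] is the reflexive transitive closure of e.                      *)
Definition embedding (V V' : finType) (e : rel V) (e' : rel V') (f : V -> V')
    : Prop :=
  injective f /\ forall u v : V, connect e u v <-> connect e' (f u) (f v).

(* There is a directed walk with exactly n edges from x to y.                 *)
Definition has_walk (V : finType) (e : rel V) (x y : V) (n : nat) : bool :=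
  [exists p : n.-tuple V, path e x p && (last x p == y)].

(* The least length of a walk is the length of a shortest path; [\bar int] is *)
(* only used as an ordered type containing the naturals and +oo.              *)
Definition dist (V : finType) (e : rel V) (x y : V) : \bar int :=
  match pselect (exists n, has_walk e x y n) with
  | left h => (Posz (ex_minn h))%:E%E
  | right _ => +oo%E
  end.

Definition distance_increasing (V V' : finType) (e : rel V) (e' : rel V')
    (f : V -> V') : Prop :=
  forall x y : V, (dist e x y <= dist e' (f x) (f y))%E.

Record placement (V : finType) :=
  Placement { inputs : {set V}; outputs : {set V} }.

Definition map_placement (V V' : finType) (f : V -> V') (chi : placement V)
    : placement V' :=
  Placement (f @: inputs chi) (f @: outputs chi).

Inductive routing := CSP | CAPminus.

(* A path is the sequence of its nodes x :: p, so a single-node path has      *)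
(* p = [::].                                                                  *)
Definition measurement_path (V : finType) (r : routing) (e : rel V)
    (chi : placement V) (s : seq V) : Prop :=
  if s is x :: p then
    [/\ path e x p, x \in inputs chi, last x p \in outputs chi &
        match r with
        | CSP => uniq (x :: p) /\ x <> last x p
        | CAPminus => ~ (p = [::] /\ x \in inputs chi :&: outputs chi)
        end]
  else False.

Definition paths_through (V : finType) (r : routing) (e : rel V)
    (chi : placement V) (v : V) : set (seq V) :=
  [set s | measurement_path r e chi s /\ v \in s]%classic.

Definition paths_meeting (V : finType) (r : routing) (e : rel V)
    (chi : placement V) (U : {set V}) : set (seq V) :=
  (\bigcup_(u in [set` U]) paths_through r e chi u)%classic.

Definition identifiable (V : finType) (r : routing) (e : rel V)
    (chi : placement V) (k : nat) : Prop :=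
  forall U W : {set V}, #|U| <= k -> #|W| <= k -> U <> W ->
    paths_meeting r e chi U <> paths_meeting r e chi W.

(* The bound k <= #|V| only serves to make the maximum exist: on a nonempty   *)
(* acyclic graph mu is the largest k at all, see [leq_mu]; on the empty graph *)
(* every k is identifiable and mu is 0.                                       *)
Definition mu (V : finType) (r : routing) (e : rel V) (chi : placement V)
    : nat :=
  \max_(k < #|V|.+1 | `[< identifiable r e chi k >]) k.

Lemma identifiableW (V : finType) (r : routing) (e : rel V)
    (chi : placement V) (j k : nat) :
  j <= k -> identifiable r e chi k -> identifiable r e chi j.
Proof.
by move=> jk idk U W Uj Wj; apply: idk; apply: leq_trans jk.
Qed.

Lemma identifiable0 (V : finType) (r : routing) (e : rel V)
    (chi : placement V) :
  identifiable r e chi 0.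
Proof.
by move=> U W; rewrite !leqn0 !cards_eq0 => /eqP-> /eqP->.
Qed.

Lemma identifiable_mu (V : finType) (r : routing) (e : rel V)
    (chi : placement V) :
  identifiable r e chi (mu r e chi).
Proof.
have id0 : `[< identifiable r e chi (ord0 : 'I_#|V|.+1) >].
  by apply/asboolP; exact: identifiable0.
rewrite /mu (bigmax_eq_arg ord0) //.
by case: arg_maxnP => // k /asboolP.
Qed.

Lemma not_identifiable_card (V : finType) (r : routing) (e : rel V)
    (chi : placement V) :
  acyclic e -> 0 < #|V| -> ~ identifiable r e chi #|V|.
Proof.
move=> acy /card_gt0P[v _] idV.
have := idV [set: V] [set~ v] (max_card _) (max_card _); apply.
  by move/setP/(_ v); rewrite !inE eqxx.
rewrite eqEsubset; split=> s [u /= _ [ms us]]; last by exists u => /=.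
suff [w ws wv] : exists2 w, w \in s & w != v.
  by exists w => /=; rewrite ?inE.
case: s ms us => [//|x p] [xp xin xout rP] _.
have [xv|xv] := eqVneq x v; last by exists x; rewrite ?mem_head.
case: p xp xout rP => [|y p] /= xp xout rP.
  by case: r idV rP => _ [] //; rewrite !inE xin xout; split.
have [yv|yv] := eqVneq y v; last by exists y; rewrite // !inE eqxx orbT.
case/andP: xp => xy _; have /negP[] : ~~ cycle e [:: x] by apply: acy.
by rewrite /= andbT {2}xv -yv.
Qed.

Lemma leq_mu (V : finType) (r : routing) (e : rel V) (chi : placement V)
    (k : nat) :
  acyclic e -> 0 < #|V| -> identifiable r e chi k <-> k <= mu r e chi.
Proof.
move=> acy V0; split=> [idk|kmu]; last first.
  exact: identifiableW kmu (@identifiable_mu _ _ _ _).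
have [kV|Vk] := ltnP k #|V|.+1.
  by rewrite /mu (bigmax_sup (Ordinal kV)) //; apply/asboolP.
by case: (not_identifiable_card acy V0 (identifiableW (ltnW Vk) idk)).
Qed.

(* Main.v *)
(** A distance-increasing bijection pulls every edge of [G'] back to an edge of
    [G]: the endpoints of such an edge are distinct and at distance at most 1
    in [G].  Hence every measurement path of [G'] is the image of one of [G],
    so two node sets that no measurement path of [G] separates have images that
    no measurement path of [G'] separates. *)
Require Import Defs.
From mathcomp Require Import all_boot all_order all_algebra.
From mathcomp Require Import boolp classical_sets constructive_ereal.

Set Implicit Arguments.
Unset Strict Implicit.
Unset Printing Implicit Defensive.

(** A finite bound rules out the value [+oo], and the minimum is attained by a walk; its length may
    be smaller than [n]. *)
Lemma has_walk_dist_le (V : finType) (e : rel V) (x y : V) (n : nat) :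
  (dist e x y <= (Posz n)%:E)%E -> exists2 m, m <= n & has_walk e x y m.
Proof.
rewrite /dist; case: pselect => [h|_]; last by rewrite leye_eq.
by case: ex_minnP => m wm _; rewrite lee_fin lez_nat => mn; exists m.
Qed.

Lemma dist_le_has_walk (V : finType) (e : rel V) (x y : V) (n : nat) :
  has_walk e x y n -> (dist e x y <= (Posz n)%:E)%E.
Proof.
move=> wn; rewrite /dist; case: pselect => [h|[]]; last by exists n.
by case: ex_minnP => m _ /(_ n wn); rewrite lee_fin lez_nat.
Qed.

Lemma has_walk_le1 (V : finType) (e : rel V) (x y : V) (n : nat) :
  n <= 1 -> has_walk e x y n -> x = y \/ e x y.
Proof.
move=> n1 /existsP[[p /= /eqP pn] /andP[xp /eqP <-]].
rewrite -pn in n1; case: p xp n1 {pn} => [|z [|? ?]] //=; first by left.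
by rewrite andbT; right.
Qed.

Lemma distance_increasing_edge (V V' : finType) (e : rel V) (e' : rel V')
    (f : V -> V') (x y : V) :
  acyclic e' -> distance_increasing e e' f -> e' (f x) (f y) -> e x y.
Proof.
move=> acy incr exy.
have w1 : has_walk e' (f x) (f y) 1.
  by apply/existsP; exists [tuple f y]; rewrite /= exy eqxx.
have [n n1 wn] :=
  has_walk_dist_le (Order.POrderTheory.le_trans (incr x y)
    (dist_le_has_walk w1)).
(* A walk of length 0 would give [x = y], turning the given edge into a self-loop at [f y], against
   acyclicity of [e']. *)
case: (has_walk_le1 n1 wn) => // xy; move: exy; rewrite xy => eyy.
by have := acy [:: f y]; rewrite /= eyy => /(_ _)/negP[].
Qed.

(** Edges pull back by hypothesis; injectivity pulls back monitor membership and the condition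
    specific to each routing. *)
Lemma measurement_path_map (V V' : finType) (r : routing) (e : rel V)
    (e' : rel V') (chi : placement V) (f : V -> V') (s : seq V) :
  injective f -> (forall x y, e' (f x) (f y) -> e x y) ->
  measurement_path r e' (map_placement f chi) (map f s) ->
  measurement_path r e chi s.
Proof.
move=> injf edge; case: s => //= x p.
rewrite path_map last_map !(mem_imset _ _ injf) => -[xp xin xout rP].
split=> //; first by apply: sub_path xp => u v; exact: edge.
case: r rP => [[]|rP].
  rewrite (mem_map injf) (map_inj_uniq injf) => xp_uniq neq.
  by split=> // xl; apply: neq; rewrite -xl.
case=> p0 /setIP[_ xo]; apply: rP.
by rewrite p0 inE !(mem_imset _ _ injf) xin xo.
Qed.

Lemma paths_meeting_imset_sub (V V' : finType) (r : routing) (e : rel V)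
    (e' : rel V') (chi : placement V) (f : V -> V') (U W : {set V}) :
  bijective f -> (forall x y, e' (f x) (f y) -> e x y) ->
  (paths_meeting r e chi U `<=` paths_meeting r e chi W)%classic ->
  (paths_meeting r e' (map_placement f chi) (f @: U) `<=`
   paths_meeting r e' (map_placement f chi) (f @: W))%classic.
Proof.
move=> bijf edge sUW s' [_ /imsetP[u uU ->] [ms' us']].
have injf := bij_inj bijf; have [g _ gK] := bijf.
have def_s' : map f (map g s') = s' by exact: mapK.
(* By surjectivity, [s'] is the image of [map g s'], which is thus a measurement path of [G] meeting
   [U], hence [W]. *)
rewrite -def_s' in ms' us' *.
have [] := sUW (map g s').
  exists u => //; split; first exact: measurement_path_map ms'.
  by rewrite -(mem_map injf).
move=> w wW [_ ws]; exists (f w); first exact: imset_f.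
by split=> //; exact: map_f.
Qed.

(** Injectivity keeps the images of [U] and [W] distinct and of unchanged size, so a confused pair
    in [G] yields one in [G']. *)
Lemma identifiable_map (V V' : finType) (r : routing) (e : rel V)
    (e' : rel V') (chi : placement V) (f : V -> V') (k : nat) :
  bijective f -> (forall x y, e' (f x) (f y) -> e x y) ->
  identifiable r e' (map_placement f chi) k -> identifiable r e chi k.
Proof.
move=> bijf edge idk U W Uk Wk neqUW eqUW.
have injf := bij_inj bijf.
apply: (idk (f @: U) (f @: W)); rewrite ?card_imset //.
  by move/(imset_inj injf).
by rewrite eqEsubset; split;
  apply: (paths_meeting_imset_sub bijf edge); rewrite eqUW.
Qed.

Theorem theorem8 (V V' : finType) (e : rel V) (e' : rel V')
    (r : routing) (chi : placement V) (f : V -> V') :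
  acyclic e -> acyclic e' ->
  bijective f -> embedding e e' f -> distance_increasing e e' f ->
  (mu r e chi >= mu r e' (map_placement f chi))%N.
Proof.
move=> _ acy' bijf _ incr.
have edge x y : e' (f x) (f y) -> e x y by exact: distance_increasing_edge acy' incr.
(* Comparing the two maxima index by index, instead of through [leq_mu], also covers empty graphs;
   equal cardinalities make the index ranges agree. *)
apply/bigmax_leqP => k /asboolP idk.
have kV : k < #|V|.+1 by rewrite (bij_eq_card bijf).
rewrite /mu (bigmax_sup (Ordinal kV)) //; apply/asboolP.
exact: identifiable_map idk.
Qed.
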